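(* Let $\mu(0),\mu(1),\mu(2),\dots$ be independent indeterminates over $\mathbb{Q}$, and let $\nu(i)=\mu(i+1)$ for all $i\ge 0$. Then for all integers $m\ge 0$ and $n\ge 1$, the following identity holds in the field of rational functions $\mathbb{Q}(\mu(0),\mu(1),\dots)$: \[ \det\left(D_j(\mu;0,i+m)\right)_{i,j=0}^{n-1} = D_0(\mu;0,m)\cdot \det\left(D_j(\nu;0,i+m)\right)_{i,j=0}^{n-2}\cdot\prod_{i=1}^{n-1}\frac{D_{i+m}(\mu;0,i+m)}{D_{i+m}(\mu;1,i+m)}. \]
   Context: For a sequence $\mu=(\mu(k))_{k\ge0}$ and integers $0\le a\le j\le b$, $D_j(\mu;a,b)$ denotes the determinant of the $(b-a)\times(b-a)$ matrix \[ \begin{pmatrix} \mu(a) & \cdots & \mu(j-1) & \mu(j+1) & \cdots & \mu(b) \\ \vdots & \ddots & \vdots & \vdots & \ddots & \vdots \\ \mu(b-1) & \cdots & \mu(j+b-a-2) & \mu(j+b-a) & \cdots & \mu(2b-a-1) \end{pmatrix}, \] that is, the matrix whose row $r$ ($0\le r\le b-a-1$) has entries $\mu(c+r)$, with $c$ running in increasing order over $\{a,a+1,\dots,b\}\setminus\{j\}$. For $0\le a\le b$ and $j<a$ or $j>b$, set $D_j(\mu;a,b)=0$. The same notation is used with $\nu$ in place of $\mu$. The determinant of an empty ($0\times0$) matrix and an empty product are both $1$. When the $\mu(k)$ are indeterminates and $a\le j\le b$, $D_j(\mu;a,b)$ is not the zero polynomial, so the denominators in the identity are nonzero. *)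

(* Defs.v *)
From HB Require Import structures.
From mathcomp Require Import all_boot all_order all_algebra.
From mathcomp Require Import finmap.
From mathcomp.multinomials Require Import monalg.

Set Implicit Arguments.
Unset Strict Implicit.
Unset Printing Implicit Defensive.

Import GRing.Theory.

Local Open Scope ring_scope.

(* [{malg R[{cmonom nat}]}] is the ring of polynomials in countably many
   variables X_0, X_1, ... over R.  The library only makes it a commutative
   ring; it is shown here to be an integral domain when R is one, so that its
   field of fractions is available.  The proof uses Kronecker's substitution
   X_i := 'X^(B ^ i), which separates the monomials of exponents < B. *)
Section PolyNatIdomain.
Variable R : idomainType.
Implicit Types (p q : {malg R[{cmonom nat}]}) (m : {cmonom nat}).

Definition kwt (B : nat) m : nat := (\sum_(i <- finsupp m) m i * B ^ i)%N.

Lemma kwtEw B m (d : {fset nat}) : (finsupp m `<=` d)%fset ->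
  kwt B m = (\sum_(i <- d) m i * B ^ i)%N.
Proof.
move=> le; rewrite /kwt (big_fset_incl _ le) //.
by move=> i _; rewrite -cmE_neq0 negbK => /eqP ->.
Qed.

Lemma kwt1 B : kwt B mone = 0%N.
Proof. by rewrite /kwt mdom1 big_seq_fset0. Qed.

Lemma kwtM B m1 m2 : kwt B (mmul m1 m2) = (kwt B m1 + kwt B m2)%N.
Proof.
rewrite {1}/kwt mdomD.
rewrite (kwtEw B (fsubsetUl _ (finsupp m2))).
rewrite (kwtEw B (fsubsetUr (finsupp m1) _)).
by rewrite -big_split /=; apply/eq_bigr=> i _; rewrite cmM mulnDl.
Qed.

Lemma kwt_ord B m N : (forall i, i \in finsupp m -> (i < N)%N) ->
  kwt B m = (\sum_(i < N) m i * B ^ i)%N.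
Proof.
move=> ltN; rewrite (@kwtEw B m [fset i in iota 0 N]%fset).
  rewrite -(big_mkord xpredT (fun i => m i * B ^ i)%N); apply: perm_big.
  apply: uniq_perm => [||i]; rewrite ?fset_uniq ?iota_uniq //.
  by rewrite in_fset /index_iota subn0.
by apply/fsubsetP=> i /ltN iN; rewrite in_fset mem_iota.
Qed.

Lemma digits_inj B N (f g : nat -> nat) :
    (forall i, f i < B)%N -> (forall i, g i < B)%N ->
    (\sum_(i < N) f i * B ^ i = \sum_(i < N) g i * B ^ i)%N ->
  forall i, (i < N)%N -> f i = g i.
Proof.
elim: N f g => // N IHN f g fB gB.
have shift (h : nat -> nat) : (\sum_(i < N.+1) h i * B ^ i =
    (\sum_(i < N) h i.+1 * B ^ i) * B + h 0)%N.
  rewrite big_ord_recl expn0 muln1 addnC big_distrl /=; congr (_ + _)%N.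
  by apply/eq_bigr=> i _; rewrite /bump /= add1n expnSr mulnA.
have B0 : (0 < B)%N by exact: leq_ltn_trans (fB 0%N).
rewrite !shift => eqfg.
have eq0 : f 0%N = g 0%N.
  by have := congr1 (modn^~ B) eqfg; rewrite /= !modnMDl !modn_small.
move=> [|i] //; rewrite ltnS => iN.
apply: (IHN (f \o succn) (g \o succn)) => //=.
by have := congr1 (divn^~ B) eqfg; rewrite /= !divnMDl // !divn_small // !addn0.
Qed.

Lemma kwt_inj B m1 m2 :
    (forall i, m1 i < B)%N -> (forall i, m2 i < B)%N ->
  kwt B m1 = kwt B m2 -> m1 = m2.
Proof.
move=> B1 B2; pose N := (\max_(i <- (finsupp m1 `|` finsupp m2)%fset) i).+1.
have ltN i : (i \in finsupp m1 `|` finsupp m2)%fset -> (i < N)%N.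
  by move=> im; rewrite ltnS; apply: (@leq_bigmax_seq _ _ xpredT id).
rewrite !(@kwt_ord B _ N); first last.
- by move=> i im; apply: ltN; rewrite in_fsetU im.
- by move=> i im; apply: ltN; rewrite in_fsetU im orbT.
move=> /(digits_inj B1 B2) eqm; apply/eqP/cmP=> i.
case: (boolP (i \in finsupp m1 `|` finsupp m2)%fset) => [/ltN/eqm //|].
by rewrite in_fsetU negb_or -!cmE_eq0 => /andP[/eqP -> /eqP ->].
Qed.

Definition kmon (B : nat) m : {poly R} := 'X^(kwt B m).

Lemma kmon_mmorphism B : mmorphism (kmon B).
Proof.
by split=> [m1 m2|]; rewrite /kmon ?kwt1 ?expr0 // kwtM exprD.
Qed.

HB.instance Definition _ B :=
  isMultiplicative.Build {cmonom nat} {poly R} (kmon B) (kmon_mmorphism B).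

Definition kron (B : nat) : {malg R[{cmonom nat}]} -> {poly R} :=
  mmap (@polyC R) (kmon B).

Lemma kronM B p q : kron B (p * q) = kron B p * kron B q.
Proof. exact: (rmorphM (mmap (@polyC R) (kmon B))). Qed.

Lemma kron0 B : kron B 0 = 0.
Proof. exact: (rmorph0 (mmap (@polyC R) (kmon B))). Qed.

Lemma kron1 B : kron B 1 = 1.
Proof. exact: (rmorph1 (mmap (@polyC R) (kmon B))). Qed.

Lemma exponent_lt B p m i :
  (mmeasure mdeg p <= B)%N -> m \in msupp p -> (m i < B)%N.
Proof.
move=> pB /(mmeasure_mnm_lt mdeg) mp; apply: leq_trans pB.
apply: leq_ltn_trans mp; rewrite /= /mdeg.
by case: mdomP => // im; rewrite (big_fsetD1 i) //= leq_addr.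
Qed.

Lemma kron_coef B p m : (mmeasure mdeg p <= B)%N -> m \in msupp p ->
  (kron B p)`_(kwt B m) = p@_m.
Proof.
move=> pB mp; rewrite /kron mmapE coef_sum (big_fsetD1 m) //=.
rewrite coefCM coefXn eqxx mulr1 big_seq big1 ?addr0 // => k.
rewrite in_fsetD1 => /andP[km kp]; rewrite coefCM coefXn.
case: eqP => [eqw|]; last by rewrite mulr0.
case/eqP: km; apply: (@kwt_inj B) => // i; exact: exponent_lt pB _.
Qed.

Lemma kron_neq0 B p : (mmeasure mdeg p <= B)%N -> p != 0 -> kron B p != 0.
Proof.
move=> pB; rewrite -msupp_eq0 => /fset0Pn[m mp].
apply/eqP => k0; have := kron_coef pB mp; rewrite k0 coef0 => /esym/eqP.
by apply/negP; rewrite mcoeff_neq0.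
Qed.

Lemma malg_nat_idomainAxiom p q : p * q = 0 -> (p == 0) || (q == 0).
Proof.
apply: contra_eqT => /norP[nz_p nz_q].
pose B := maxn (mmeasure mdeg p) (mmeasure mdeg q).
apply/eqP => /(congr1 (kron B))/eqP; rewrite kronM kron0 mulf_eq0.
by apply/negP; rewrite negb_or !kron_neq0 ?leq_maxl ?leq_maxr.
Qed.

Definition malg_nat_unit : pred {malg R[{cmonom nat}]} :=
  fun p => (p == (p@_mone)%:MP) && (p@_mone \is a GRing.unit).

Definition malg_nat_inv p :=
  if p \in malg_nat_unit then ((p@_mone)^-1)%:MP else p.

Lemma malg_nat_mulVp : {in malg_nat_unit, left_inverse 1 malg_nat_inv *%R}.
Proof.
move=> p Up; rewrite /malg_nat_inv Up; case/andP: Up.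
by move/eqP=> {3}->; rewrite -mpolyCM => /mulVr ->.
Qed.

Lemma malg_nat_intro_unit p q : q * p = 1 -> malg_nat_unit p.
Proof.
move=> qp1; apply/andP; split; last first.
  have qp1' : q@_mone * p@_mone = 1 by rewrite -rmorphM qp1 rmorph1.
  by apply/unitrP; exists q@_mone; split; rewrite // mulrC.
pose B := mmeasure mdeg p.
have szp : size (kron B p) == 1%N.
  have := congr1 (kron B) qp1; rewrite kronM kron1 mulrC => k1.
  have : kron B p %| 1 by rewrite -k1 dvdp_mulr.
  by rewrite dvdp1.
apply/eqP/malgP => m; rewrite mcoeffC; have [-> //|m1] := eqVneq m mone.
apply/eqP; rewrite mulr0n mcoeff_eq0; apply: contra m1 => mp.
have /eqP wt0 : kwt B m == 0%N.
  rewrite -leqn0 -ltnS -(eqP szp) ltnNge.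
  apply/negP => /leq_sizeP/(_ _ (leqnn _)); rewrite kron_coef // => /eqP.
  by apply/negP; rewrite mcoeff_neq0.
apply/eqP/(@kwt_inj B) => [i|i|]; first exact: exponent_lt mp.
  by rewrite cm1; apply: leq_ltn_trans (exponent_lt 0 (leqnn _) mp).
by rewrite kwt1.
Qed.

Lemma malg_nat_inv_out : {in [predC malg_nat_unit], malg_nat_inv =1 id}.
Proof. by rewrite /malg_nat_inv => p /negbTE /= ->. Qed.

HB.instance Definition _ :=
  GRing.ComNzRing_hasMulInverse.Build (malg {cmonom nat} R)
    malg_nat_mulVp malg_nat_intro_unit malg_nat_inv_out.
HB.instance Definition _ :=
  GRing.ComUnitRing_isIntegral.Build (malg {cmonom nat} R)
    malg_nat_idomainAxiom.

End PolyNatIdomain.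

Definition Qmu : fieldType := {fraction {malg rat[{cmonom nat}]}}.

Definition indet (k : nat) : Qmu :=
  tofrac (<< ucm k >> : {malg rat[{cmonom nat}]}).

(* Column c of the matrix carries the (c+1)-st smallest element of
   {a, ..., b} \ {j}, namely [bump j (a + c)], which is a + c if a + c < j and
   a + c + 1 otherwise.  Only used for a <= b. *)
Definition D (R : comNzRingType) (j : nat) (mu : nat -> R) (a b : nat) : R :=
  if (a <= j <= b)%N then
    \det (\matrix_(r < b - a, c < b - a) mu (bump j (a + c) + r)%N)
  else 0.

(* Main.v *)
(* Up to sign, D_j(mu;0,k) is the coefficient of x^j in the (unnormalized)
   orthogonal polynomial P_k of the moment sequence mu, and D_j(nu;0,k) is the
   one of the polynomial Q_k for the moments shifted by one.  Christoffel's
   formula writes P_{k+1} as a combination of x Q_k and P_k, the multiplier of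
   x Q_k being D_{k+1}(mu;0,k+1) / D_{k+1}(mu;1,k+1).  Subtracting from each row
   of the left-hand matrix a multiple of the row above thus leaves D_0(mu;0,m)
   as the only nonzero entry of column 0, and the complementary minor is the
   matrix for nu with its rows rescaled. *)
Require Import Defs.
From HB Require Import structures.
From mathcomp Require Import all_boot all_order all_algebra.
From mathcomp Require Import perm finmap ring.
From mathcomp.multinomials Require Import monalg.

Set Implicit Arguments.
Unset Strict Implicit.
Unset Printing Implicit Defensive.

Import GRing.Theory.

Local Open Scope ring_scope.

(** The determinant is D_k(mu;0,k) for [s = 0]; for [s = 1] it is at once D_0(mu;0,k),
    D_(k+1)(mu;1,k+1) and D_k(nu;0,k). *)
Definition hankel (R : comNzRingType) (mu : nat -> R) (s k : nat) : 'M[R]_k :=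
  \matrix_(r, c) mu (s + c + r)%N.

Section Minors.
Variables (R : comNzRingType) (mu : nat -> R).
Implicit Types j k r : nat.

Lemma D0E j k : D j mu 0 k =
  if (j <= k)%N then \det (\matrix_(r < k, c < k) mu (bump j c + r)%N) else 0.
Proof. by rewrite /D subn0. Qed.

Lemma D0_gt j k : (k < j)%N -> D j mu 0 k = 0.
Proof. by move=> kj; rewrite D0E leqNgt kj. Qed.

Lemma D0_first k : D 0 mu 0 k = \det (hankel mu 1 k).
Proof. by rewrite D0E. Qed.

Lemma D0_last k : D k mu 0 k = \det (hankel mu 0 k).
Proof.
rewrite D0E leqnn; congr (\det _); apply/matrixP=> r c; rewrite !mxE.
by rewrite /bump leqNgt ltn_ord.
Qed.

Lemma D1_last k : D k.+1 mu 1 k.+1 = \det (hankel mu 1 k).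
Proof.
rewrite /D leqnn subSS subn0; congr (\det _); apply/matrixP=> r c; rewrite !mxE.
by rewrite /bump add1n ltnNge ltn_ord.
Qed.

(* Orthogonality of P_k to x^r: a determinant with a repeated row vanishes. *)
Lemma D0_orthogonal k r : (r < k)%N ->
  \sum_(j < k.+1) (-1) ^+ j * D j mu 0 k * mu (j + r)%N = 0.
Proof.
move=> rk.
(* Row 0 repeats row [r.+1]; expansion along row 0 gives the sum. *)
pose M := \matrix_(i < k.+1, j < k.+1)
  mu (j + (if i == 0%N :> nat then r else i.-1))%N.
have : \det M = 0.
  apply: (@determinant_alternate _ _ _ ord0 (lift ord0 (Ordinal rk))) => // j.
  by rewrite !mxE.
rewrite (expand_det_row _ ord0) => M0; rewrite -[RHS]M0; apply: eq_bigr => j _.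
rewrite mxE eqxx mulrC; congr (_ * _).
rewrite /cofactor add0n D0E -ltnS ltn_ord; congr (_ * \det _).
by apply/matrixP=> i c; rewrite !mxE.
Qed.

End Minors.

Lemma D0_last_shift (R : comNzRingType) (mu : nat -> R) k :
  D k (fun i => mu i.+1) 0 k = \det (hankel mu 1 k).
Proof. by rewrite D0_last; congr (\det _); apply/matrixP=> r c; rewrite !mxE. Qed.

(* The difference of both sides, with signs, is a vector orthogonal to
   x^0, ..., x^(k-1) whose entries 0 and k+1 vanish, hence it is killed by the
   invertible matrix [hankel mu 1 k]. *)
Lemma christoffel (F : fieldType) (mu : nat -> F) (j k : nat) :
  \det (hankel mu 1 k) != 0 ->
  D j.+1 mu 0 k.+1 * \det (hankel mu 1 k) =
    \det (hankel mu 0 k.+1) * D j (fun i => mu i.+1) 0 k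
    + \det (hankel mu 1 k.+1) * D j.+1 mu 0 k.
Proof.
move=> nzH; pose nu i := mu i.+1.
have [jk|jk|->] := ltngtP j k; first last.
- rewrite D0_last_shift D0_last (D0_gt _ (ltnSn k)); ring.
- by rewrite !D0_gt //; [ring | exact: ltnW].
pose w i := (-1) ^+ i.+1 * (D i.+1 mu 0 k.+1 * \det (hankel mu 1 k)
  - \det (hankel mu 0 k.+1) * D i nu 0 k
  - \det (hankel mu 1 k.+1) * D i.+1 mu 0 k).
suff w0 : \row_(i < k) w i = 0.
  have /eqP := congr1 (fun v : 'rV_k => v 0 (Ordinal jk)) w0.
  by rewrite !mxE mulf_eq0 signr_eq0 /= -addrA -opprD subr_eq0 => /eqP.
have uH : hankel mu 1 k \in unitmx by rewrite unitmxE unitfE.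
suff wH : \row_(i < k) w i *m (hankel mu 1 k)^T = 0.
  by rewrite -[LHS](mulmxK (_ : (hankel mu 1 k)^T \in unitmx)) ?unitmx_tr // wH
             mul0mx.
apply/rowP=> r; rewrite !mxE.
have wk : w k = 0.
  rewrite /w D0_last D0_last_shift (D0_gt _ (ltnSn k)); ring.
have orth1 := D0_orthogonal mu (ltnW (ltn_ord r) : (r < k.+1)%N).
have orth2 := D0_orthogonal nu (ltn_ord r).
have orth3 := D0_orthogonal mu (ltn_ord r).
(* The added term [i = k] is zero by [wk]; it completes the ranges of the orthogonality sums. *)
transitivity (\sum_(i < k.+1) w i * mu (i.+1 + r)%N).
  rewrite big_ord_recr /= wk mul0r addr0; apply: eq_bigr => i _.
  by rewrite !mxE add1n.
have -> : \sum_(i < k.+1) w i * mu (i.+1 + r)%N =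
  \det (hankel mu 1 k) *
    (\sum_(i < k.+1) (-1) ^+ i.+1 * D i.+1 mu 0 k.+1 * mu (i.+1 + r)%N)
  + \det (hankel mu 0 k.+1) *
    (\sum_(i < k.+1) (-1) ^+ i * D i nu 0 k * nu (i + r)%N)
  - \det (hankel mu 1 k.+1) *
    (\sum_(i < k.+1) (-1) ^+ i.+1 * D i.+1 mu 0 k * mu (i.+1 + r)%N).
  rewrite !mulr_sumr -sumrN -!big_split /=; apply: eq_bigr => i _.
  by rewrite /w /nu addSn exprS; ring.
(* The sum for [nu] vanishes. The other two lack only the term of index 0 of an orthogonality
   relation, so each equals minus that term, and their contributions cancel. *)
rewrite orth2.
move: orth1; rewrite big_ord_recl /= D0_first => /eqP; rewrite addrC addr_eq0.
move=> /eqP ->.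
have -> : \sum_(i < k.+1) (-1) ^+ i.+1 * D i.+1 mu 0 k * mu (i.+1 + r)%N
  = - (\det (hankel mu 1 k) * mu r).
  move: orth3; rewrite big_ord_recl /= D0_first mul1r => /eqP.
  rewrite addrC addr_eq0 => /eqP <-.
  by rewrite big_ord_recr /= (D0_gt _ (ltnSn k)) mulr0 mul0r addr0.
by rewrite add0n; ring.
Qed.

(** Genericity of [mu] enters only through the nonzero determinants by which the row multipliers
    divide. *)
Lemma det_D_reduction (F : fieldType) (mu : nat -> F) (m n : nat) :
  (forall k, \det (hankel mu 1 k) != 0) ->
  \det (\matrix_(i < n.+1, j < n.+1) D j mu 0 (i + m)) =
    D 0 mu 0 m
    * \det (\matrix_(i < n, j < n) D j (fun i => mu i.+1) 0 (i + m))
    * \prod_(1 <= i < n.+1) (D (i + m) mu 0 (i + m) / D (i + m) mu 1 (i + m)).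
Proof.
move=> nzH; set A := \matrix_(i, j) _; set Q := \matrix_(i, j) _.
pose h k := \det (hankel mu 1 k).
(* Christoffel's multiplier of x Q_k for [k = i + m]. *)
pose rho i := \det (hankel mu 0 (i + m).+1) / h (i + m)%N.
(* Unit lower bidiagonal. As D_0(mu;0,k) is [h k], these multipliers clear column 0 below its top
   entry. *)
pose E := \matrix_(i < n.+1, j < n.+1)
  ((i == j)%:R - (i == j.+1 :> nat)%:R * (h (j + m).+1 / h (j + m)%N)).
have detE : \det E = 1.
  rewrite det_trig.
    rewrite big1 // => i _.
    by rewrite mxE eqxx (ltn_eqF (ltnSn i)) mul0r subr0.
  apply/is_trig_mxP => i j ij.
  rewrite mxE -val_eqE /= (ltn_eqF ij) (ltn_eqF (ltn_trans ij (ltnSn j))).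
  by rewrite mul0r subr0.
have EA0 j : (E *m A) ord0 j = D j mu 0 m.
  rewrite mxE (bigD1 ord0) //= big1 => [|i i0].
    by rewrite !mxE mul0r subr0 mul1r addr0.
  by rewrite !mxE eq_sym (negbTE i0) mul0r subr0 mul0r.
have EAS i j : (E *m A) (lift ord0 i) j =
    D j mu 0 (i + m).+1 - h (i + m).+1 / h (i + m)%N * D j mu 0 (i + m).
  rewrite mxE; under eq_bigr => l _ do rewrite mulrC !mxE mulrBr.
  rewrite sumrB (bigD1 (lift ord0 i)) //= eqxx mulr1 big1 => [|l li]; last first.
    by rewrite eq_sym (negbTE li) mulr0.
  rewrite (bigD1 (widen_ord (leqnSn n) i)) //= big1 => [|l li]; last first.
    rewrite /bump /= add1n eqSS eq_sym.
    by move: li; rewrite -val_eqE /= => /negbTE ->; rewrite mul0r mulr0.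
  by rewrite /bump /= add1n addSn eqxx mul1r !addr0; congr (_ - _); rewrite mulrC.
have -> : \det A = \det (E *m A) by rewrite det_mulmx detE mul1r.
rewrite (expand_det_col _ ord0) big_ord_recl big1 ?addr0 => [|i _]; last first.
  by rewrite EAS /= !D0_first -/(h _) -/(h _) divfK ?subrr ?mul0r ?nzH.
rewrite EA0 -mulrA; congr (_ * _).
rewrite /cofactor expr0 mul1r.
(* Column [j.+1] of the reduced matrix meets column [j] of [Q], by Christoffel's formula. *)
have -> : row' ord0 (col' ord0 (E *m A)) = diag_mx (\row_i rho i) *m Q.
  apply/matrixP => i j; rewrite mul_diag_mx.
  rewrite [LHS]mxE [LHS]mxE EAS !mxE /= /bump /= add1n.
  have H := christoffel j (nzH (i + m)%N).
  apply: (mulIf (nzH (i + m)%N)); rewrite mulrBl H /rho /h.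
  by field; exact: nzH.
rewrite det_mulmx det_diag mulrC; congr (_ * _).
rewrite big_add1 /= big_mkord; apply: eq_bigr => i _.
by rewrite mxE addSn D0_last D1_last.
Qed.

Section Specialization.
Variables (k : nat).

(* The specialization X_k := 1 and X_i := 0 for i <> k. *)
Definition spec_mon (x : {cmonom nat}) : rat := (finsupp x `<=` [fset k])%fset%:R.

Lemma spec_mon_mmorphism : mmorphism spec_mon.
Proof.
split=> [x y|]; rewrite /spec_mon; last by rewrite mdom1 fsub0set.
by rewrite mdomD fsubUset -mulnb natrM.
Qed.

HB.instance Definition _ :=
  isMultiplicative.Build {cmonom nat} rat spec_mon spec_mon_mmorphism.

Definition spec : {malg rat[{cmonom nat}]} -> rat := mmap idfun spec_mon.
HB.instance Definition _ := GRing.RMorphism.on spec.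

Lemma spec_ucm i : spec << ucm i >> = (i == k)%:R.
Proof. by rewrite /spec mmapU mul1r /= /spec_mon mdomU fsub1set in_fset1. Qed.

End Specialization.

(** A polynomial with a nonzero specialization is nonzero. Entry (r,c) is X_(1+c+r), which [spec k]
    sends to 1 exactly when c = k-1-r: the matrix of the reversal permutation, of determinant 1 or
    -1. *)
Lemma det_hankel_indet_neq0 k : \det (hankel indet 1 k) != 0.
Proof.
pose H := hankel (fun i => << ucm i >> : {malg rat[{cmonom nat}]}) 1 k.
have -> : hankel indet 1 k = map_mx (@tofrac _) H.
  by apply/matrixP => r c; rewrite !mxE.
rewrite det_map_mx tofrac_eq0.
suff : spec k (\det H) != 0 by apply: contra_neq => ->; rewrite rmorph0.
rewrite -det_map_mx.
have -> : map_mx (spec k) H = perm_mx (perm (@rev_ord_inj k)).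
  apply/matrixP => r c; rewrite !mxE spec_ucm permE -val_eqE /=.
  by rewrite -(eqn_add2r r.+1 (k - r.+1)) subnK // eq_sym add1n addnS.
by rewrite det_perm signr_eq0.
Qed.

Theorem theorem1 (m n : nat) (hn : (1 <= n)%N) :
  let mu : nat -> Qmu := indet in
  let nu : nat -> Qmu := fun i => mu i.+1 in
  \det (\matrix_(i < n, j < n) D j mu 0 (i + m)) =
    D 0 mu 0 m
    * \det (\matrix_(i < n.-1, j < n.-1) D j nu 0 (i + m))
    * \prod_(1 <= i < n) (D (i + m) mu 0 (i + m) / D (i + m) mu 1 (i + m)).
Proof.
case: n hn => // n _ mu nu.
exact: det_D_reduction det_hankel_indet_neq0.
Qed.
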